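(* Let $\mathcal V$ be a quantale, $\kappa$ a cardinal, and $h\colon\mathcal V^\kappa\nrightarrow\mathcal V^\kappa$ the structure of the $\mathcal V$-category $(\mathcal V^\kappa)^{\mathrm{op}}$. Let $\widehat F$ be a lax extension of a functor $F\colon\mathsf{Set}\to\mathsf{Set}$ to $\mathcal V\text{-}\mathsf{Rel}$. Then, under the Yoneda bijection between $\kappa$-ary predicate liftings for $F$ and maps $F\mathcal V^\kappa\to\mathcal V$, the $\kappa$-ary Moss liftings induced by $\widehat F$ correspond precisely to the representable $\mathcal V$-functors $(F\mathcal V^\kappa,\widehat Fh)\to\mathcal V^{\mathrm{op}}$ with representing objects in the image of the map $F1_\kappa^\sharp\colon F\kappa\to F\mathcal V^\kappa$, i.e. to the maps of the form $\mathfrak v\mapsto\widehat Fh(\mathfrak v,F1_\kappa^\sharp(\mathfrak k))$ with $\mathfrak k\in F\kappa$.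
   Context: A quantale $\mathcal V$ is a complete lattice with a commutative monoid structure $(\otimes,k)$ such that each $u\otimes-$ preserves suprema; $\hom(u,-)$ denotes the right adjoint of $u\otimes -$. A $\mathcal V$-relation $r\colon X\nrightarrow Y$ is a map $X\times Y\to\mathcal V$. For $r\colon X\nrightarrow Y$, $s\colon Y\nrightarrow Z$, the composite is $(s\cdot r)(x,z)=\bigvee_{y}r(x,y)\otimes s(y,z)$; $1_X$ has value $k$ on the diagonal and $\bot$ elsewhere; $\mathcal V\text{-}\mathsf{Rel}$ is the category of sets and $\mathcal V$-relations. $\mathcal V$-relations are ordered pointwise; $r^\circ(y,x)=r(x,y)$ is the converse. A function $f\colon X\to Y$ is regarded as the $\mathcal V$-relation with value $k$ on the graph of $f$ and $\bot$ elsewhere. An element of a set $A$ is regarded as a function $1\to A$. A lax extension of $F$ to $\mathcal V\text{-}\mathsf{Rel}$ is an assignment $(r\colon X\nrightarrow Y)\mapsto(\widehat Fr\colon FX\nrightarrow FY)$ such that (L1) $r\le r'$ implies $\widehat Fr\le\widehat Fr'$; (L2) $\widehat Fs\cdot\widehat Fr\le\widehat F(s\cdot r)$; (L3) $Ff\le\widehat Ff$ and $(Ff)^\circ\le\widehat F(f^\circ)$ for all functions $f$. A $\mathcal V$-category $(X,a)$ is a set $X$ with $a\colon X\nrightarrow X$ satisfying $1_X\le a$ and $a\cdot a\le a$; its dual is $(X,a)^{\mathrm{op}}=(X,a^\circ)$. A $\mathcal V$-functor $f\colon(X,a)\to(Y,b)$ is a map with $a(x,y)\le b(f(x),f(y))$.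 $\mathcal V$ is a $\mathcal V$-category with structure $\hom$, and $\mathcal V^\kappa$ with structure $[p,q]=\bigwedge_{i\in\kappa}\hom(p(i),q(i))$; thus $h(p,q)=[q,p]$. A $\mathcal V$-functor $(X,a)\to\mathcal V^{\mathrm{op}}$ is representable with representing object $x\in X$ if it is $a(-,x)$. For $r\colon X\nrightarrow\kappa$, $r^\sharp\colon X\to\mathcal V^\kappa$ denotes the curried function $r^\sharp(x)(i)=r(x,i)$; in particular $1_\kappa^\sharp\colon\kappa\to\mathcal V^\kappa$ is the currying of the identity $\mathcal V$-relation. A $\kappa$-ary predicate lifting for $F$ is a natural transformation $\mu\colon\mathsf{Set}(-,\mathcal V^\kappa)\to\mathsf{Set}(F-,\mathcal V)$; by the Yoneda lemma it corresponds to the map $\mu_{\mathcal V^\kappa}(\mathrm{id})\colon F\mathcal V^\kappa\to\mathcal V$. Via currying, $\mu$ is also viewed as sending $\mathcal V$-relations $f\colon X\nrightarrow\kappa$ to $\mathcal V$-relations $\mu(f)\colon FX\nrightarrow1$. For $\mathfrak k\in F\kappa$, the Moss lifting $\mu^{\mathfrak k}$ induced by $\widehat F$ is the $\kappa$-ary predicate lifting $\mu^{\mathfrak k}(f)=\mathfrak k^\circ\cdot\widehat Ff$. *)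

(* Defs.v *)
From HB Require Import structures.
From mathcomp Require Import all_boot all_order.
From mathcomp Require Export boolp classical_sets functions.

Set Implicit Arguments.
Unset Strict Implicit.
Unset Printing Implicit Defensive.

Import Order.TTheory.
Local Open Scope classical_set_scope.
Local Open Scope order_scope.

(* A complete lattice is a partial order in which every subset has a least
   upper bound; bottom, infima and the right adjoint of the tensor are derived
   from suprema below. *)
HB.mixin Record POrder_isQuantale d (V : Type) of Order.POrder d V := {
  qsup : set V -> V;
  qsup_isLub : forall A : set V, isLub A (qsup A);
  tens : V -> V -> V;
  tunit : V;
  tensA : associative tens;
  tensC : commutative tens;
  tens1l : left_id tunit tens;
  tens_sup : forall (u : V) (A : set V),
    tens u (qsup A) = qsup [set tens u v | v in A];
}.

#[short(type="quantaleType")]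
HB.structure Definition Quantale d :=
  {V of Order.POrder d V & POrder_isQuantale d V}.

Arguments qsup {d V} A : rename.
Arguments tens {d V} u v : rename.
Arguments tunit {d V} : rename.

Declare Scope quantale_scope.
Delimit Scope quantale_scope with Q.
Notation "u ⊗ v" := (tens u v) (at level 40, left associativity) : quantale_scope.
Open Scope quantale_scope.

Section QuantaleTheory.
Context {d : Order.disp_t} {V : quantaleType d}.
Implicit Types (u v w : V) (A : set V).

Definition qbot : V := qsup set0.
Definition qinf A : V := qsup (lbound A).
Definition qhom u w : V := qsup [set v | u ⊗ v <= w].

Lemma qsup_ub A v : A v -> v <= qsup A.
Proof. by case: (qsup_isLub A) => + _; apply. Qed.

Lemma qsup_least A v : (forall w, A w -> w <= v) -> qsup A <= v.
Proof. by case: (qsup_isLub A) => _; apply. Qed.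

Lemma qbot_le v : qbot <= v.
Proof. exact: qsup_least. Qed.

Lemma qinf_lb A v : A v -> qinf A <= v.
Proof. by move=> Av; apply: qsup_least => w; apply. Qed.

Lemma qinf_greatest A v : (forall w, A w -> v <= w) -> v <= qinf A.
Proof. by move=> vA; apply: qsup_ub. Qed.

Lemma tens1r v : v ⊗ tunit = v.
Proof. by rewrite tensC tens1l. Qed.

Lemma tens_le2l u v w : v <= w -> u ⊗ v <= u ⊗ w.
Proof.
move=> vw; have -> : w = qsup [set v; w].
  apply/le_anti/andP; split; first by apply: qsup_ub; right.
  by apply: qsup_least => _ [->|->].
by rewrite tens_sup; apply: qsup_ub; exists v => //; left.
Qed.

Lemma tens_le2r u v w : v <= w -> v ⊗ u <= w ⊗ u.
Proof. by rewrite ![_ ⊗ u]tensC; apply: tens_le2l. Qed.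

Lemma tens_bot u : u ⊗ qbot = qbot.
Proof. by rewrite /qbot tens_sup image_set0. Qed.

Lemma qhom_adj u v w : u ⊗ v <= w <-> v <= qhom u w.
Proof.
split=> [uvw|vh]; first exact: qsup_ub.
apply: le_trans (tens_le2l u vh) _.
by rewrite tens_sup; apply: qsup_least => _ [x /= + <-].
Qed.

End QuantaleTheory.

(* V-relations X × Y -> V are kept curried. *)
Definition vrel d (V : quantaleType d) (X Y : Type) := X -> Y -> V.


Section VRel.
Context {d : Order.disp_t} {V : quantaleType d}.

Definition vle {X Y} (r s : vrel V X Y) : Prop := forall x y, r x y <= s x y.

(* Composition is in applicative order: [vcomp s r] is s · r. *)
Definition vcomp {X Y Z} (s : vrel V Y Z) (r : vrel V X Y) : vrel V X Z :=
  fun x z => qsup (range (fun y => r x y ⊗ s y z)).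

Definition vconv {X Y} (r : vrel V X Y) : vrel V Y X := fun y x => r x y.

Definition vgraph {X Y} (f : X -> Y) : vrel V X Y :=
  fun x y => if `[< f x = y >] then tunit else qbot.

Definition vid (X : Type) : vrel V X X :=
  fun x y => if `[< x = y >] then tunit else qbot.

Definition sharp {X K} (r : vrel V X K) : X -> (K -> V) := fun x i => r x i.

Lemma vle_trans {X Y} (r s t : vrel V X Y) : vle r s -> vle s t -> vle r t.
Proof. by move=> rs st x y; apply: le_trans (rs x y) (st x y). Qed.

Lemma vcomp_le {X Y Z} (s s' : vrel V Y Z) (r r' : vrel V X Y) :
  vle s s' -> vle r r' -> vle (vcomp s r) (vcomp s' r').
Proof.
move=> ss rr x z; apply: qsup_least => _ [y _ <-].
apply: (@le_trans _ _ (r' x y ⊗ s' y z)); last by apply: qsup_ub; exists y.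
exact: le_trans (tens_le2r _ (rr x y)) (tens_le2l _ (ss y z)).
Qed.

Lemma vcomp_ge {X Y Z} (s : vrel V Y Z) (r : vrel V X Y) x y z :
  r x y ⊗ s y z <= vcomp s r x z.
Proof. by apply: qsup_ub; exists y. Qed.

Lemma vgraph_id (X : Type) : vgraph (@id X) = @vid X.
Proof. by []. Qed.

Lemma vgraph_refl {X Y} (f : X -> Y) x : vgraph f x (f x) = tunit.
Proof. by rewrite /vgraph asboolT. Qed.

Lemma vcomp_graphr {X Y Z} (s : vrel V Y Z) (f : X -> Y) :
  vcomp s (vgraph f) = fun x z => s (f x) z.
Proof.
apply/funext => x; apply/funext => z; apply/le_anti/andP; split; last first.
  by have := vcomp_ge s (vgraph f) x (f x) z; rewrite vgraph_refl tens1l.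
apply: qsup_least => _ [y _ <-]; rewrite /vgraph.
case: asboolP => [->|_]; first by rewrite tens1l.
by rewrite tensC tens_bot qbot_le.
Qed.

End VRel.

Arguments vid {d V} X _ _.

Structure vcat d (V : quantaleType d) := VCat {
  vob :> Type;
  vstr : vrel V vob vob;
  vcat_id : vle (vid vob) vstr;
  vcat_comp : vle (vcomp vstr vstr) vstr
}.

Section VCat.
Context {d : Order.disp_t} {V : quantaleType d}.

Lemma vid_leP {X} (a : vrel V X X) :
  (forall x, tunit <= a x x) -> vle (vid X) a.
Proof.
by move=> ax x y; rewrite /vid; case: asboolP => [->|_]; rewrite ?ax ?qbot_le.
Qed.

Lemma vcomp_leP {X} (a : vrel V X X) :
  (forall x y z, a x y ⊗ a y z <= a x z) -> vle (vcomp a a) a.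
Proof. by move=> aT x z; apply: qsup_least => _ [y _ <-]. Qed.

Lemma vstr_refl (A : vcat V) (x : A) : tunit <= vstr x x.
Proof. by have := vcat_id x x; rewrite /vid asboolT. Qed.

Lemma vstr_trans (A : vcat V) (x y z : A) : vstr x y ⊗ vstr y z <= vstr x z.
Proof. exact: le_trans (vcomp_ge _ _ _ _ _) (vcat_comp x z). Qed.

Lemma qhom_refl (u : V) : tunit <= qhom u u.
Proof. by apply/qhom_adj; rewrite tens1r. Qed.

Lemma qhom_eval (u v : V) : u ⊗ qhom u v <= v.
Proof. exact/qhom_adj. Qed.

Lemma qhom_trans (u v w : V) : qhom u v ⊗ qhom v w <= qhom u w.
Proof.
apply: (proj1 (qhom_adj _ _ _)); rewrite tensA.
exact: le_trans (tens_le2r _ (qhom_eval u v)) (qhom_eval v w).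
Qed.

Definition vop (A : vcat V) : vcat V.
Proof.
refine (@VCat d V A (vconv (@vstr d V A)) _ _).
- by apply: vid_leP => x; apply: vstr_refl.
- by apply: vcomp_leP => x y z; rewrite /vconv tensC; apply: vstr_trans.
Defined.

Definition vself : vcat V.
Proof.
refine (@VCat d V V qhom _ _).
- by apply: vid_leP => u; apply: qhom_refl.
- by apply: vcomp_leP => u v w; apply: qhom_trans.
Defined.

Definition powstr (K : Type) : vrel V (K -> V) (K -> V) :=
  fun p q => qinf (range (fun i => qhom (p i) (q i))).

Definition vpow (K : Type) : vcat V.
Proof.
refine (@VCat d V (K -> V) (@powstr K) _ _).
- apply: vid_leP => p; apply: qinf_greatest => _ [i _ <-].
  exact: qhom_refl.
- apply: vcomp_leP => p q r; apply: qinf_greatest => _ [i _ <-].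
  apply: le_trans (qhom_trans _ (q i) _).
  apply: (@le_trans _ _ (qhom (p i) (q i) ⊗ powstr q r)).
    by apply: tens_le2r; apply: qinf_lb; exists i.
  by apply: tens_le2l; apply: qinf_lb; exists i.
Defined.

Definition is_vfunctor (A B : vcat V) (f : A -> B) : Prop :=
  forall x y : A, vstr x y <= vstr (f x) (f y).

Definition represented_by (A : vcat V) (f : A -> vop vself) (x : A) : Prop :=
  f = (fun y : A => vstr y x).

End VCat.

Arguments vself {d} V.
Arguments vpow {d} V K.

Structure functor := Functor {
  fobj :> Type -> Type;
  fmap : forall X Y : Type, (X -> Y) -> fobj X -> fobj Y;
  fmap_id : forall X : Type, fmap (@id X) = id;
  fmap_comp : forall (X Y Z : Type) (g : Y -> Z) (f : X -> Y),
    fmap (g \o f) = fmap g \o fmap f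
}.

Arguments fmap F {X Y} f _ : rename.

Structure lax_extension d (V : quantaleType d) (F : functor) := LaxExtension {
  lax :> forall X Y : Type, vrel V X Y -> vrel V (F X) (F Y);
  lax_mono : forall (X Y : Type) (r r' : vrel V X Y),
    vle r r' -> vle (lax r) (lax r');
  lax_comp : forall (X Y Z : Type) (s : vrel V Y Z) (r : vrel V X Y),
    vle (vcomp (lax s) (lax r)) (lax (vcomp s r));
  lax_graph : forall (X Y : Type) (f : X -> Y),
    vle (vgraph (fmap F f)) (lax (vgraph f));
  lax_graphV : forall (X Y : Type) (f : X -> Y),
    vle (vconv (vgraph (fmap F f))) (lax (vconv (vgraph f)))
}.

(* Components are taken on functions X -> V^K; as V-relations are curried,
   these are literally the V-relations from X to K. *)
Structure predlift d (V : quantaleType d) (F : functor) (K : Type) := PredLift {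
  plift :> forall X : Type, (X -> (K -> V)) -> (F X -> V);
  plift_nat : forall (X Y : Type) (g : X -> Y) (f : Y -> (K -> V)),
    plift (f \o g) = plift f \o fmap F g
}.

Section PredicateLiftings.
Context {d : Order.disp_t} {V : quantaleType d} {F : functor}.

Definition lax_vcat (L : lax_extension V F) (A : vcat V) : vcat V.
Proof.
refine (@VCat d V (F A) (L A A (@vstr d V A)) _ _).
- apply: (@vle_trans _ _ _ _ _ (L A A (vid A))).
    by have := lax_graph L (@id A); rewrite fmap_id.
  by apply: lax_mono; apply: vcat_id.
- apply: vle_trans (lax_comp L _ _) _.
  by apply: lax_mono; apply: vcat_comp.
Defined.

Definition yoneda {K : Type} (mu : predlift V F K) : F (K -> V) -> V :=
  mu (K -> V) id.

Definition yoneda_inv {K : Type} (phi : F (K -> V) -> V) : predlift V F K.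
Proof.
refine (@PredLift d V F K (fun X f => phi \o fmap F f) _).
by move=> X Y g f; rewrite fmap_comp.
Defined.

Lemma predlift_ext {K : Type} (mu nu : predlift V F K) :
  (forall X f, mu X f = nu X f) -> mu = nu.
Proof.
case: mu nu => [m mP] [n nP] /= mn.
have E : m = n by apply: functional_extensionality_dep => X; apply/funext/mn.
by subst n; rewrite (Prop_irrelevance mP nP).
Qed.

Lemma yoneda_bij {K : Type} : bijective (@yoneda K).
Proof.
exists yoneda_inv => [mu|phi]; last by rewrite /yoneda /= fmap_id.
by apply: predlift_ext => X f; exact: esym (plift_nat mu f id).
Qed.

Lemma lax_comp_graph (L : lax_extension V F) {X Y Z : Type} (s : vrel V Y Z)
    (f : X -> Y) :
  L X Z (vcomp s (vgraph f)) = vcomp (L Y Z s) (vgraph (fmap F f)).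
Proof.
apply/funext => x; apply/funext => z; apply/le_anti/andP; split; last first.
  apply: le_trans (lax_comp L s (vgraph f) x z).
  by apply: vcomp_le => //; apply: lax_graph.
rewrite [leRHS](congr1 (fun r => r x z) (vcomp_graphr _ _)).
set r := vcomp s _.
have : L Y Z (vcomp r (vconv (vgraph f))) (fmap F f x) z
       <= L Y Z s (fmap F f x) z.
  apply: lax_mono => y z'; apply: qsup_least => _ [x' _ <-].
  rewrite /r vcomp_graphr /vconv /vgraph.
  case: asboolP => [->|_]; first by rewrite tens1l.
  by rewrite tensC tens_bot qbot_le.
apply: le_trans; apply: le_trans (lax_comp L _ _ _ _).
apply: le_trans (vcomp_ge _ _ _ x _).
rewrite -[leLHS]tens1l; apply: tens_le2r.
by have := lax_graphV L f (fmap F f x) x; rewrite /vconv vgraph_refl.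
Qed.

(* k is viewed as a map from the one-point type [unit]. *)
Definition moss (L : lax_extension V F) {K : Type} (k : F K) :
  predlift V F K.
Proof.
refine (@PredLift d V F K (fun X f x =>
  vcomp (vconv (vgraph (fun _ : unit => k))) (L X K f) x tt) _).
move=> X Y g f; apply/funext => x /=.
have -> : f \o g = vcomp f (vgraph g) by rewrite vcomp_graphr.
by rewrite lax_comp_graph vcomp_graphr.
Defined.

End PredicateLiftings.

(* Main.v *)
Require Import Defs.
From mathcomp Require Import all_boot all_order.
From mathcomp Require Import boolp classical_sets functions.
Local Open Scope classical_set_scope.

(** The identity of [K -> V], read as a relation from [K -> V] to [K], is the
    evaluation [p, j |-> p j], and the map that the Yoneda bijection assigns to
    the Moss lifting of [k] is [v |-> L ev v k], for [ev] this evaluation.  The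
    Yoneda lemma for quantale-enriched categories gives [p j = h p (1# j)],
    since [1# j] is the presheaf represented by [j] on the discrete category
    [K]; that is, [ev] is [h] followed by the converse of [1#]
    ([powstr_sharp_vid]).  A lax extension
    preserves such composites with converses of functions
    ([lax_comp_graph_conv]), hence [L ev v k = L h v (F 1# k)]
    ([yoneda_moss]), which is the functor represented by [F 1# k].  Everything
    else is formal: every map [a(-, x)] is an enriched functor into the dual of
    the quantale ([representable_vfunctor]), and the Yoneda bijection is
    injective. *)

Section Representability.
Context {d : Order.disp_t} {V : quantaleType d}.
Local Open Scope order_scope.
Import Order.TTheory.

Lemma vcomp_graph_conv {X Y Z : Type} (g : Z -> Y) (r : vrel V X Y) :
  vcomp (vconv (vgraph g)) r = fun x z => r x (g z).
Proof.
apply/funext => x; apply/funext => z; apply/le_anti/andP; split.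
  apply: qsup_least => _ [y _ <-]; rewrite /vconv /vgraph.
  by case: asboolP => [->|_]; rewrite ?tens1r // tens_bot qbot_le.
have := vcomp_ge (vconv (vgraph g)) r x (g z) z.
by rewrite /vconv vgraph_refl tens1r.
Qed.

(** The inequality [<=] uses that [g] composed with its converse lies below the
    identity; the inequality [>=] is laxness together with the axiom for the
    converses of functions. *)
Lemma lax_comp_graph_conv {F : functor} (L : lax_extension V F)
    {X Y Z : Type} (g : Z -> Y) (r : vrel V X Y) :
  L X Z (vcomp (vconv (vgraph g)) r)
  = vcomp (vconv (vgraph (fmap F g))) (L X Y r).
Proof.
apply/funext => x; apply/funext => z; apply/le_anti/andP; split; last first.
  apply: le_trans (lax_comp L (vconv (vgraph g)) r x z).
  by apply: vcomp_le => //; apply: lax_graphV.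
rewrite [leRHS](congr1 (fun r => r x z) (vcomp_graph_conv _ _)).
set s := vcomp _ r.
have : L X Y (vcomp (vgraph g) s) x (fmap F g z) <= L X Y r x (fmap F g z).
  apply: lax_mono => x' y; apply: qsup_least => _ [z' _ <-].
  rewrite /s vcomp_graph_conv /vgraph.
  by case: asboolP => [->|_]; rewrite ?tens1r // tens_bot qbot_le.
apply: le_trans; apply: le_trans (lax_comp L _ _ _ _).
apply: le_trans (vcomp_ge _ _ _ z _).
rewrite -[leLHS]tens1r; apply: tens_le2l.
by have := lax_graph L g z (fmap F g z); rewrite vgraph_refl.
Qed.

(** Yoneda: [1# j] is the unit at [j] and bottom elsewhere, and [hom] out of the
    unit is the identity while [hom] out of bottom is the top element. *)
Lemma powstr_sharp_vid {K : Type} (j : K) (p : K -> V) :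
  powstr (sharp (vid K) j) p = p j.
Proof.
apply/le_anti/andP; split.
  have : powstr (sharp (vid K) j) p <= qhom (sharp (vid K) j j) (p j).
    by apply: qinf_lb; exists j.
  move=> /le_trans; apply.
  rewrite /sharp /vid asboolT // -[leLHS]tens1l; exact: qhom_eval.
apply: qinf_greatest => _ [i _ <-]; apply/qhom_adj.
rewrite /sharp /vid; case: asboolP => [->|_]; first by rewrite tens1l.
by rewrite tensC tens_bot qbot_le.
Qed.

Lemma yoneda_moss {F : functor} (L : lax_extension V F) {K : Type} (k : F K) :
  yoneda (moss L k)
  = fun v => L _ _ (vstr (v := vop (vpow V K))) v (fmap F (sharp (vid K)) k).
Proof.
apply/funext => v; rewrite /yoneda /= vcomp_graph_conv.
(* Here [id] is the evaluation relation from [K -> V] to [K]. *)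
have -> : id = vcomp (vconv (vgraph (sharp (vid K)))) (vconv (@powstr d V K)).
  rewrite vcomp_graph_conv; apply/funext => p; apply/funext => j.
  by rewrite /vconv powstr_sharp_vid.
by rewrite lax_comp_graph_conv vcomp_graph_conv.
Qed.

Lemma representable_vfunctor (A : vcat V) (x : A) :
  is_vfunctor (B := vop (vself V)) (fun y : A => vstr y x).
Proof. by move=> y z; apply/qhom_adj; rewrite tensC; apply: vstr_trans. Qed.

End Representability.

Theorem theorem3p13 (d : Order.disp_t) (V : quantaleType d) (K : Type)
    (F : functor) (L : lax_extension V F) :
  let VKop : vcat V := vop (vpow V K) in
  let h : vrel V (K -> V) (K -> V) := vstr (v := VKop) in
  let unit_map : F K -> F (K -> V) := fmap F (sharp (vid K)) in
  let moss_liftings : set (predlift V F K) :=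
    [set mu | exists k : F K, mu = moss L k] in
  let representables : set (F (K -> V) -> V) :=
    [set phi | is_vfunctor (A := lax_vcat L VKop) (B := vop (vself V)) phi /\
       exists2 x : F (K -> V), range unit_map x &
         represented_by (A := lax_vcat L VKop) phi x] in
  set_bij moss_liftings representables yoneda /\
  representables =
    [set phi | exists k : F K, phi = (fun v => L _ _ h v (unit_map k))].
Proof.
move=> VKop h unit_map moss_liftings representables.
have repr_vfunctor k : representables (fun v => L _ _ h v (unit_map k)).
  split; first exact: (@representable_vfunctor d V (lax_vcat L VKop)).
  by exists (unit_map k) => //; exists k.
have repr_image phi : representables phi ->
    exists k, phi = (fun v => L _ _ h v (unit_map k)).
  by move=> [_ [_ [k _ <-] ->]]; exists k.
split; [split|].
- by move=> _ [k ->]; rewrite yoneda_moss; apply: repr_vfunctor.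
- by move=> mu nu _ _; apply: (bij_inj yoneda_bij).
- move=> phi /repr_image[k ->]; exists (moss L k); first by exists k.
  exact: yoneda_moss.
- apply/seteqP; split=> phi; first exact: repr_image.
  by move=> [k ->]; apply: repr_vfunctor.
Qed.
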